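(* Let $A$ be a finite alphabet. Considered both as families of languages (defined by sentences) and as families of sets of marked words (defined by formulas with one free variable), the logics $FO^2[<,\mathrm{betfac}]$ and $FO^2[<,\mathrm{thfac}]$ over $A$ have the same expressive power.
   Context: Words over a finite alphabet $A$ have positions $1,\dots,|w|$; $w(i)$ is the $i$-th letter; a marked word is $(w,i)$ with $w$ nonempty and $1\le i\le|w|$. First-order logic over words uses the order $<$ and unary predicates $a(x)$ ($a\in A$) meaning the letter at $x$ is $a$. For $u=a_1\cdots a_n\in A^+$, an occurrence of the factor $u$ strictly between $x$ and $y$ means positions $z,z+1,\dots,z+n-1$ with $x<z$, $z+n-1<y$ and $w(z+t-1)=a_t$ for $t=1,\dots,n$. $FO^2[<,\mathrm{betfac}]$ is the two-variable first-order logic (only two variable symbols, which may be reused) built from $<$, the unary letter predicates, and for each $u\in A^+$ the binary predicate $\langle u\rangle(x,y)$: there is an occurrence of $u$ strictly between $x$ and $y$. $FO^2[<,\mathrm{thfac}]$ is the two-variable logic built from $<$, the unary letter predicates and, for each $u\in A^+$ and integer $k\ge 0$, the binary predicate asserting that there are at least $k$ (possibly overlapping) occurrences of $u$ strictly between $x$ and $y$. Sentences of these logics are interpreted only in nonempty words. *)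

(* Defs.v *)
From mathcomp Require Import all_boot.

Set Implicit Arguments.
Unset Strict Implicit.
Unset Printing Implicit Defensive.

Definition nonempty_word (A : finType) := {w : seq A | w != [::]}.

(* Positions of w are the elements of 'I_(size w), hence numbered from 0. *)
Definition marked_word (A : finType) := {w : seq A & 'I_(size w)}.

(* The two variable symbols. *)
Definition var := bool.

(* Two-variable formulas over <, the letter predicates, and a family of binary
   predicate symbols indexed by P. The remaining connectives and the universal
   quantifier are the usual abbreviations. *)
Inductive fo2 (A : finType) (P : Type) : Type :=
| Lt of var & var
| Letter of A & var
| Pred of P & var & var
| Not of fo2 A P
| And of fo2 A P & fo2 A P
| Ex of var & fo2 A P.

Fixpoint free (A : finType) (P : Type) (v : var) (phi : fo2 A P) : bool :=
  match phi with
  | Lt x y | Pred _ x y => (v == x) || (v == y)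
  | Letter _ x => v == x
  | Not psi => free v psi
  | And psi chi => free v psi || free v chi
  | Ex x psi => (v != x) && free v psi
  end.

Definition is_sentence (A : finType) (P : Type) (phi : fo2 A P) : Prop :=
  forall v, ~~ free v phi.

Definition has_only_free (A : finType) (P : Type) (v : var) (phi : fo2 A P) :
    Prop :=
  forall v', free v' phi -> v' = v.

Definition interpretation (A : finType) (P : Type) :=
  P -> forall w : seq A, rel 'I_(size w).

Definition update (T : Type) (e : var -> T) (x : var) (i : T) : var -> T :=
  fun y => if y == x then i else e y.

Fixpoint sat (A : finType) (P : Type) (I : interpretation A P) (w : seq A)
    (e : var -> 'I_(size w)) (phi : fo2 A P) : bool :=
  match phi with
  | Lt x y => e x < e y
  | Letter a x => tnth (in_tuple w) (e x) == a
  | Pred p x y => I p w (e x) (e y)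
  | Not psi => ~~ sat I e psi
  | And psi chi => sat I e psi && sat I e chi
  | Ex x psi => [exists i : 'I_(size w), sat I (update e x i) psi]
  end.

(* Starting positions of the occurrences of u in w strictly between x and y. *)
Definition occurrences (A : finType) (u w : seq A) (x y : 'I_(size w)) :
    {set 'I_(size w)} :=
  [set z : 'I_(size w) |
     [&& x < z, z + (size u).-1 < y & prefix u (drop z w)]].

Definition betfac (A : finType) : interpretation A (nonempty_word A) :=
  fun u w x y => [exists z, z \in occurrences (val u) x y].

Definition thfac (A : finType) : interpretation A (nonempty_word A * nat) :=
  fun uk w x y => uk.2 <= #|occurrences (val uk.1) x y|.

(* The truth value of a sentence does not depend on the valuation, and a
   nonempty word has at least one valuation. *)
Definition defines_language (A : finType) (P : Type) (I : interpretation A P)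
    (phi : fo2 A P) (L : nonempty_word A -> Prop) : Prop :=
  forall w, L w <-> forall e : var -> 'I_(size (val w)), sat I e phi.

Definition definable_language (A : finType) (P : Type)
    (I : interpretation A P) (L : nonempty_word A -> Prop) : Prop :=
  exists2 phi : fo2 A P, is_sentence phi & defines_language I phi L.

(* At most one variable is free in phi, so it is harmless to send both variables
   to the marked position. *)
Definition defines_marked (A : finType) (P : Type) (I : interpretation A P)
    (phi : fo2 A P) (M : marked_word A -> Prop) : Prop :=
  forall (w : seq A) (i : 'I_(size w)),
    M (existT _ w i) <-> sat I (fun=> i) phi.

Definition definable_marked (A : finType) (P : Type)
    (I : interpretation A P) (M : marked_word A -> Prop) : Prop :=
  exists v (phi : fo2 A P), has_only_free v phi /\ defines_marked I phi M.

(* Main.v *)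
(* A threshold atom need not be equivalent to a betfac formula, but quantifying
   one of its variables away is harmless. Call a binary relation R on positions
   good if "some y with R x y (or R y x) satisfies Q" is definable for every
   definable unary Q; good relations are closed under union, composition and
   unary tests. Fix M and K bounding the factors and thresholds of a formula.
   Its binary atoms are determined by the order of x and y, the last M letters
   strictly between them, and the number, truncated at K, of each window of
   length M+1 there. Fixing those data gives a good relation: if E is the set
   of windows whose count has reached K, the positions between x and y form a
   word in a finite union of products E* b1 E* b2 ... bn E*, and "only windows
   of E in between" is a negated betfac condition. By induction every formula
   is then a boolean function of definable colours of x and of y and of these
   data. *)
Require Import Defs.
From mathcomp Require Import all_boot.
From mathcomp Require Import zify.

Set Implicit Arguments.
Unset Strict Implicit.
Unset Printing Implicit Defensive.

(** * Definable relations and predicates on positions *)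

Definition word_rel (A : finType) := forall w : seq A, rel 'I_(size w).
Definition word_pred (A : finType) := forall w : seq A, pred 'I_(size w).

(* Quantifying over the variable v that plays the role of the first argument
   spares the renaming of variables in formulas. *)
Definition definable2 (A : finType) (P : Type) (I : interpretation A P)
    (R : word_rel A) : Prop :=
  forall v : var, exists phi : fo2 A P,
    forall w (e : var -> 'I_(size w)), sat I e phi = R w (e v) (e (~~ v)).

(** A predicate is encoded as a relation that ignores its second argument, so the closure lemmas for
    relations apply to it unchanged. *)
Definition definable1 (A : finType) (P : Type) (I : interpretation A P)
    (Q : word_pred A) : Prop :=
  definable2 I (fun w x _ => Q w x).

Lemma definable2_ext (A : finType) (P : Type) (I : interpretation A P)
    (R S : word_rel A) :
  (forall w x y, R w x y = S w x y) -> definable2 I R -> definable2 I S.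
Proof.
by move=> RS defR v; have [phi phiP] := defR v; exists phi => w e; rewrite phiP.
Qed.

Lemma definable2C (A : finType) (P : Type) (I : interpretation A P)
    (R : word_rel A) :
  definable2 I R -> definable2 I (fun w x y => R w y x).
Proof.
move=> defR v; have [phi phiP] := defR (~~ v).
by exists phi => w e; rewrite phiP negbK.
Qed.

Lemma definable2_not (A : finType) (P : Type) (I : interpretation A P)
    (R : word_rel A) :
  definable2 I R -> definable2 I (fun w x y => ~~ R w x y).
Proof.
move=> defR v; have [phi phiP] := defR v.
by exists (Not phi) => w e /=; rewrite phiP.
Qed.

Lemma definable2_and (A : finType) (P : Type) (I : interpretation A P)
    (R S : word_rel A) :
  definable2 I R -> definable2 I S ->
  definable2 I (fun w x y => R w x y && S w x y).
Proof.
move=> defR defS v; have [phi phiP] := defR v; have [psi psiP] := defS v.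
by exists (And phi psi) => w e /=; rewrite phiP psiP.
Qed.

Lemma definable2_lt (A : finType) (P : Type) (I : interpretation A P) :
  definable2 I (fun w x y => x < y).
Proof. by move=> v; exists (Lt A P v (~~ v)). Qed.

Lemma definable2_const (A : finType) (P : Type) (I : interpretation A P)
    (b : bool) :
  definable2 I (fun _ _ _ => b).
Proof.
move=> v; case: b; last by exists (Lt A P v v) => w e /=; rewrite ltnn.
by exists (Not (Lt A P v v)) => w e /=; rewrite ltnn.
Qed.

Lemma definable2_all (A : finType) (P : Type) (I : interpretation A P)
    (T : Type) (s : seq T) (R : T -> word_rel A) :
  (forall t, definable2 I (R t)) ->
  definable2 I (fun w x y => all (fun t => R t w x y) s).
Proof.
move=> defR; elim: s => [|t s IHs] /=; first exact: definable2_const.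
exact: definable2_and.
Qed.

Lemma definable2_forall (A : finType) (P : Type) (I : interpretation A P)
    (T : finType) (R : T -> word_rel A) :
  (forall t, definable2 I (R t)) ->
  definable2 I (fun w x y => [forall t, R t w x y]).
Proof.
move=> /(definable2_all (enum T)); apply: definable2_ext => w x y.
by apply/allP/forallP => [Rxy t|Rxy t _] //; apply: Rxy; rewrite mem_enum.
Qed.

Lemma definable2_exists (A : finType) (P : Type) (I : interpretation A P)
    (T : finType) (R : T -> word_rel A) :
  (forall t, definable2 I (R t)) ->
  definable2 I (fun w x y => [exists t, R t w x y]).
Proof.
move=> defR.
have := definable2_not (definable2_forall (fun t => definable2_not (defR t))).
by apply: definable2_ext => w x y; rewrite negb_forall; apply: eq_existsb => t;
  rewrite negbK.
Qed.

Lemma definable1_exists (A : finType) (P : Type) (I : interpretation A P)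
    (T : finType) (Q : T -> word_pred A) :
  (forall t, definable1 I (Q t)) ->
  definable1 I (fun w x => [exists t, Q t w x]).
Proof. exact: (definable2_exists (R := fun t w x _ => Q t w x)). Qed.

Lemma definable1_exists_var (A : finType) (P : Type) (I : interpretation A P)
    (R : word_rel A) :
  definable2 I R -> definable1 I (fun w x => [exists y, R w x y]).
Proof.
move=> defR v; have [phi phiP] := defR v.
exists (Ex (~~ v) phi) => w e /=; apply: eq_existsb => i.
by rewrite phiP /update eqxx; case: (v).
Qed.

Lemma definable1_letter (A : finType) (P : Type) (I : interpretation A P)
    (a : A) :
  definable1 I (fun w x => tnth (in_tuple w) x == a).
Proof. by move=> v; exists (Letter P a v). Qed.

(** * Good relations and their closure properties *)

Definition good (A : finType) (P : Type) (I : interpretation A P)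
    (R : word_rel A) : Prop :=
  forall Q : word_pred A, definable1 I Q ->
    definable1 I (fun w x => [exists y, R w x y && Q w y]) /\
    definable1 I (fun w x => [exists y, R w y x && Q w y]).

Lemma good_ext (A : finType) (P : Type) (I : interpretation A P)
    (R S : word_rel A) :
  (forall w x y, R w x y = S w x y) -> good I R -> good I S.
Proof.
move=> RS goodR Q /goodR[defR defRC].
by split; [move: defR | move: defRC]; apply: definable2_ext => w x _;
  apply: eq_existsb => y; rewrite RS.
Qed.

Lemma goodC (A : finType) (P : Type) (I : interpretation A P)
    (R : word_rel A) :
  good I R -> good I (fun w x y => R w y x).
Proof. by move=> goodR Q /goodR[]. Qed.

Lemma definable2_good (A : finType) (P : Type) (I : interpretation A P)
    (R : word_rel A) :
  definable2 I R -> good I R.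
Proof.
move=> defR Q defQ; split; apply: definable1_exists_var.
  exact: definable2_and defR (definable2C defQ).
exact: definable2_and (definable2C defR) (definable2C defQ).
Qed.

(** The endpoints are eliminated one at a time: the positions [z] with an [S]-successor in [Q] form
    a definable predicate, to which goodness of [R] applies; symmetrically in the other direction.
    No stage keeps more than two positions in play. *)
Lemma good_comp (A : finType) (P : Type) (I : interpretation A P)
    (R S : word_rel A) :
  good I R -> good I S ->
  good I (fun w x y => [exists z, R w x z && S w z y]).
Proof.
move=> goodR goodS Q defQ; split.
  have [+ _] := goodR _ (proj1 (goodS _ defQ)); apply: definable2_ext.
  move=> w x _; apply/existsP/existsP => [[z /andP[xz /existsP[y]]]|[y]].
    case/andP=> zy yQ; exists y; rewrite yQ andbT.
    by apply/existsP; exists z; rewrite xz.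
  case/andP=> /existsP[z /andP[xz zy]] yQ; exists z; rewrite xz.
  by apply/existsP; exists y; rewrite zy.
have [_ +] := goodS _ (proj2 (goodR _ defQ)); apply: definable2_ext.
move=> w x _; apply/existsP/existsP => [[z /andP[xz /existsP[y]]]|[y]].
  case/andP=> zy yQ; exists y; rewrite yQ andbT.
  by apply/existsP; exists z; rewrite xz zy.
case/andP=> /existsP[z /andP[xz zy]] yQ; exists z; rewrite zy.
by apply/existsP; exists y; rewrite xz.
Qed.

Lemma good_test (A : finType) (P : Type) (I : interpretation A P)
    (R : word_rel A) (Q : word_pred A) :
  good I R -> definable1 I Q -> good I (fun w x y => R w x y && Q w x).
Proof.
move=> goodR defQ Q' defQ'; split.
  have := definable2_and (proj1 (goodR _ defQ')) defQ.
  apply: definable2_ext => w x _; apply/andP/existsP => [[]|[y]].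
    by case/existsP=> y /andP[xy yQ'] xQ; exists y; rewrite xy xQ.
  case/andP=> /andP[xy xQ] yQ'; split=> //.
  by apply/existsP; exists y; rewrite xy.
have := proj2 (goodR _ (definable2_and defQ defQ')).
by apply: definable2_ext => w x _; apply: eq_existsb => y; rewrite andbA.
Qed.

Lemma good_exists (A : finType) (P : Type) (I : interpretation A P)
    (T : finType) (R : T -> word_rel A) :
  (forall t, good I (R t)) -> good I (fun w x y => [exists t, R t w x y]).
Proof.
move=> goodR Q defQ; split.
  have := definable1_exists (fun t => proj1 (goodR t Q defQ)).
  apply: definable2_ext => w x _; apply/existsP/existsP => [[t]|[y]].
    case/existsP=> y /andP[xy yQ]; exists y; rewrite yQ andbT.
    by apply/existsP; exists t.
  case/andP=> /existsP[t xy] yQ; exists t.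
  by apply/existsP; exists y; rewrite xy.
have := definable1_exists (fun t => proj2 (goodR t Q defQ)).
apply: definable2_ext => w x _; apply/existsP/existsP => [[t]|[y]].
  case/existsP=> y /andP[xy yQ]; exists y; rewrite yQ andbT.
  by apply/existsP; exists t.
case/andP=> /existsP[t xy] yQ; exists t.
by apply/existsP; exists y; rewrite xy.
Qed.

(** * Distances, shifts and factors read at a position *)

Lemma definable2_betfac (A : finType) (u : seq A) :
  u != [::] ->
  definable2 (@betfac A)
    (fun w x y => [exists z, z \in occurrences u x y]).
Proof.
move=> u_n0 v.
by exists (Pred A (exist _ u u_n0 : nonempty_word A) v (~~ v)).
Qed.

Lemma tuple_neq_nil (A : finType) (n : nat) (t : n.+1.-tuple A) :
  val t != [::].
Proof. by rewrite -size_eq0 size_tuple. Qed.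

(** There is room for [k] letters strictly between [x] and [y] exactly when one of the finitely many
    words of length [k] occurs there. The case [k = 0] is apart because factors are nonempty. *)
Lemma definable2_dist (A : finType) (k : nat) :
  definable2 (@betfac A) (fun w x y => x + k < y).
Proof.
case: k => [|k]; first by
  apply: definable2_ext (definable2_lt _) => w x y; rewrite addn0.
have := definable2_exists (fun t : k.+1.-tuple A =>
  definable2_betfac (tuple_neq_nil t)).
apply: definable2_ext => w x y; apply/existsP/idP => [[t /existsP[z]]|xy].
  rewrite inE size_tuple => /and3P[]; lia.
have y_lt := ltn_ord y.
have sz : size (take k.+1 (drop x.+1 w)) == k.+1.
  rewrite size_takel // size_drop; lia.
exists (Tuple sz); apply/existsP.
have zP : x.+1 < size w by lia.
exists (Ordinal zP); rewrite inE (eqP sz) /= prefix_take; lia.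
Qed.

Lemma definable2_succ (A : finType) :
  definable2 (@betfac A) (fun w x y => y == x.+1 :> nat).
Proof.
have := definable2_and (definable2_dist A 0)
  (definable2_not (definable2_dist A 1)).
apply: definable2_ext => w x y; lia.
Qed.

Lemma good_shift (A : finType) (k : nat) :
  good (@betfac A) (fun w x y => y == x + k :> nat).
Proof.
elim: k => [|k IHk].
  apply: definable2_good.
  have := definable2_and (definable2_not (definable2_lt (@betfac A)))
    (definable2_not (definable2C (definable2_lt (@betfac A)))).
  apply: definable2_ext => w x y; lia.
have := good_comp (definable2_good (definable2_succ A)) IHk.
apply: good_ext => w x y; apply/existsP/idP => [[z]|/eqP xy]; first lia.
have zP : x.+1 < size w by have := ltn_ord y; lia.
exists (Ordinal zP) => /=; lia.
Qed.

Lemma definable1_prefix (A : finType) (u : seq A) :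
  definable1 (@betfac A) (fun w x => prefix u (drop x w)).
Proof.
elim: u => [|a u IHu].
  by apply: definable2_ext (definable2_const _ true) => w x _; rewrite prefix0s.
(* The guard [u != [::]] matters at the last position, where an empty remainder is a prefix although
   no successor exists. *)
have := definable2_and (definable1_letter (@betfac A) a)
  (definable2_not (definable2_and (definable2_const _ (u != [::]))
     (definable2_not (proj1 (definable2_good (definable2_succ A) IHu))))).
apply: definable2_ext => w x _.
rewrite (tnth_nth a) /= (drop_nth a) ?ltn_ord // prefix_cons eq_sym negb_and.
rewrite !negbK; congr (_ && _); apply/orP/idP => [[/eqP->|]|].
- by rewrite prefix0s.
- by case/existsP=> y /andP[/eqP->].
case: eqP => [_ _|/eqP u_n0 pu]; [by left|right].
have xP : x.+1 < size w.
  case: ltnP pu => // xP; rewrite drop_oversize //.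
  by case: (u) u_n0.
by apply/existsP; exists (Ordinal xP); rewrite eqxx.
Qed.

(** * Windows of length [M + 1] and their counts *)

Definition window_count (A : finType) (b w : seq A) (x z : nat) : nat :=
  \sum_(x.+1 <= i < z) prefix b (drop i w).

Lemma window_count_split (A : finType) (b w : seq A) (x y z : nat) :
  x < y -> y < z ->
  window_count b w x z =
    window_count b w x y + prefix b (drop y w) + window_count b w y z.
Proof.
move=> xy yz; rewrite /window_count (@big_cat_nat _ _ _ y) //=; last exact: ltnW.
by rewrite (big_ltn yz) addnA.
Qed.

Lemma window_count_gt0 (A : finType) (b w : seq A) (x z : nat) :
  reflect (exists2 i, x < i < z & prefix b (drop i w))
    (0 < window_count b w x z).
Proof.
rewrite lt0n /window_count sum_nat_seq_neq0.
apply: (iffP hasP) => [[i]|[i xiz bi]].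
  by rewrite mem_index_iota => xiz; rewrite eqb0 negbK; exists i.
by exists i; rewrite ?mem_index_iota //= eqb0 negbK.
Qed.

Lemma prefix_tuple_inj (A : finType) (n : nat) (s t : n.-tuple A) (w : seq A) :
  prefix s w -> prefix t w = (t == s).
Proof.
rewrite !prefixE !size_tuple => /eqP ->; by rewrite -val_eqE eq_sym.
Qed.

(* The bound on z + M makes every window starting before z complete. *)
Definition window_counts (A : finType) (M : nat) (E : {set M.+1.-tuple A})
    (m : M.+1.-tuple A -> nat) : word_rel A :=
  fun w x z =>
    [&& x < z, z + M < size w &
        [forall b, if b \in E then m b <= window_count b w x z
                   else window_count b w x z == m b]].

(** A window starting at [i] ends at [i + M], so it lies before [z + M] exactly when [i < z]. *)
Lemma betfac_window_count (A : finType) (M : nat) (b : M.+1.-tuple A)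
    (w : seq A) (x z y : 'I_(size w)) :
  y = z + M :> nat ->
  [exists i, i \in occurrences b x y] = (0 < window_count b w x z).
Proof.
move=> yE; apply/existsP/window_count_gt0 => [[i]|[i xiz bi]].
  rewrite inE size_tuple yE /= ltn_add2r => /and3P[xi iz bi].
  by exists i; rewrite ?xi.
have iP : i < size w by have := ltn_ord z; lia.
by exists (Ordinal iP); rewrite inE size_tuple yE /= ltn_add2r bi andbT.
Qed.

(** The absence of windows outside [E] is a conjunction of negated betfac atoms on [x] and [z + M];
    composing with the shift back by [M] reaches [z]. *)
Lemma good_window_counts0 (A : finType) (M : nat) (E : {set M.+1.-tuple A}) :
  good (@betfac A) (window_counts E (fun=> 0)).
Proof.
have defE := definable2_forall (fun b : M.+1.-tuple A => definable2_not
  (definable2_and (definable2_const (@betfac A) (b \notin E))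
     (definable2_betfac (tuple_neq_nil b)))).
have := good_comp (definable2_good (definable2_and (definable2_dist A M) defE))
  (goodC (good_shift (A := A) M)).
apply: good_ext => w x z; apply/existsP/idP => [[y]|].
  case/andP=> /andP[xy /forallP noE] /eqP yE.
  apply/and3P; split; [lia | by rewrite -yE | apply/forallP => b].
  have:= noE b; rewrite (betfac_window_count _ _ yE).
  by case: (b \in E) => //=; rewrite -eqn0Ngt.
case/and3P=> xz zM /forallP noE; exists (Ordinal zM); rewrite /= eqxx andbT.
rewrite ltn_add2r xz; apply/forallP => b.
have := noE b; rewrite (@betfac_window_count _ _ _ _ _ z) //.
by case: (b \in E) => //= /eqP->.
Qed.

(* The first position whose window still has a positive prescribed count is
   preceded by windows of E only. *)
Lemma window_counts_step (A : finType) (M : nat) (E : {set M.+1.-tuple A})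
    (m : M.+1.-tuple A -> nat) (w : seq A) (x z : 'I_(size w)) :
  (exists b, 0 < m b) ->
  window_counts E m x z =
    [exists b : M.+1.-tuple A, [exists y : 'I_(size w),
       window_counts E (fun=> 0) x y &&
       (window_counts E (fun b' => m b' - (b' == b)) y z &&
        ((0 < m b) && prefix b (drop y w)))]].
Proof.
move=> [b0 m0]; apply/idP/existsP => [/and3P[xz zM /forallP cE]|[b /existsP[y]]].
  pose p i := (x < i < z) && [exists b, (0 < m b) && prefix b (drop i w)].
  have ex_p : exists i, p i.
    have : 0 < window_count b0 w x z.
      by have := cE b0; case: ifP => _ => [|/eqP->//]; apply: leq_trans.
    case/window_count_gt0=> i xiz bi; exists i; rewrite /p xiz /=.
    by apply/existsP; exists b0; rewrite m0.
  case: (ex_minnP ex_p) => i /andP[/andP[xi iz] /existsP[b /andP[mb bi]]] min_i.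
  have iP : i < size w by have := ltn_ord z; lia.
  have first_i b' : 0 < m b' -> window_count b' w x i = 0.
    move=> mb'; apply/eqP; rewrite eqn0Ngt; apply/window_count_gt0.
    case=> j /andP[xj ji] b'j; suff: i <= j by lia.
    apply: min_i; rewrite /p xj (ltn_trans ji iz) /=.
    by apply/existsP; exists b'; rewrite mb'.
  have splitE (b' : M.+1.-tuple A) : window_count b' w x z =
      window_count b' w x i + (b' == b) + window_count b' w i z.
    by rewrite (window_count_split _ _ xi iz) (prefix_tuple_inj _ bi).
  exists b; apply/existsP; exists (Ordinal iP); rewrite mb bi !andbT.
  apply/andP; split; apply/and3P; split=> //=; try lia.
    (* Outside [E], a window with [m b' = 0] occurs nowhere between [x] and [z], and one with
       [0 < m b'] does not occur before [i] by minimality. *)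
    apply/forallP => b'; have := cE b'; case: (b' \in E) => //.
    have := first_i b'; have := splitE b'; lia.
  apply/forallP => b'; have := cE b'; have := splitE b'; have := first_i b'.
  case: eqP => [->|_]; case: (_ \in E); lia.
case/and3P=> /and3P[xy _ /forallP cxy] /and3P[yz zM /forallP cyz] /andP[mb yb].
apply/and3P; split=> //; first exact: ltn_trans yz.
apply/forallP => b'; have := cxy b'; have := cyz b'.
rewrite (window_count_split _ _ xy yz) (prefix_tuple_inj _ yb).
(* Since [0 < m b], the truncated subtraction at [b] is exact and is undone by the window at [y]. *)
case: eqP => [->|_]; case: (_ \in E); lia.
Qed.

(** Induction on the total prescribed count: each round peels off one window, and the choice of that
    window is a finite union of compositions. *)
Lemma good_window_counts (A : finType) (M : nat) (E : {set M.+1.-tuple A})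
    (m : M.+1.-tuple A -> nat) :
  good (@betfac A) (window_counts E m).
Proof.
have [n] := ubnP (\sum_b m b); elim: n m => // n IHn m sum_m.
have [/existsP ex_m|no_m] := boolP [exists b, 0 < m b]; last first.
  apply: good_ext (good_window_counts0 E) => w x z; rewrite /window_counts.
  congr [&& _, _ & _]; apply: eq_forallb => b; suff -> : m b = 0 by [].
  by move: no_m; rewrite negb_exists => /forallP/(_ b); rewrite -eqn0Ngt => /eqP.
have good_b b : good (@betfac A) (fun w (x z : 'I_(size w)) =>
    [exists y : 'I_(size w), window_counts E (fun=> 0) x y &&
       (window_counts E (fun b' => m b' - (b' == b)) y z &&
        ((0 < m b) && prefix b (drop y w)))]).
  apply: good_comp (good_window_counts0 E) _.
  have [mb|_] := boolP (0 < m b); last first.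
    apply: good_ext (definable2_good (definable2_const _ false)) => w x y.
    by rewrite /= andbF.
  apply: good_test (definable1_prefix _); apply: IHn.
  (* The term for [b] drops by one because [0 < m b], and no other term grows. *)
  move: sum_m; rewrite ltnS; apply: leq_trans; rewrite [X in _ < X](bigD1 b) //= (bigD1 b) //=.
  rewrite eqxx -addSn leq_add ?subn1 ?prednK //.
  by apply: leq_sum => b' _; apply: leq_subr.
apply: good_ext (good_exists good_b) => w x z.
exact/esym/window_counts_step.
Qed.

(** * Signatures of intervals *)

Definition signature (A : finType) (M K : nat) : finType :=
  ({ffun M.+1.-tuple A -> 'I_K.+1} * M.-bseq A)%type.

(* Their occurrences are those missed when counting the factors of length at
   most M+1 strictly between x and y as prefixes of windows of length M+1. *)
Definition last_letters (A : finType) (M : nat) (w : seq A) (x y : nat) :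
    seq A :=
  drop (maxn x.+1 (y - M)) (take y w).

(** The counted windows start before [y - M], hence end before [y]. When at most [M] letters lie
    between [x] and [y], the range of starts is empty. *)
Definition sig (A : finType) (M K : nat) (w : seq A) (x y : nat) :
    signature A M K :=
  ([ffun b : M.+1.-tuple A => inord (minn K (window_count b w x (y - M)))],
   insub_bseq M (last_letters M w x y)).

Lemma size_last_letters (A : finType) (M : nat) (w : seq A) (x y : nat) :
  x < y -> y <= size w -> size (last_letters M w x y) = minn M (y - x.+1).
Proof. move=> xy yw; rewrite size_drop size_takel //; lia. Qed.

Lemma sig1E (A : finType) (M K : nat) (w : seq A) (x y : nat)
    (b : M.+1.-tuple A) :
  (sig M K w x y).1 b = minn K (window_count b w x (y - M)) :> nat.
Proof. by rewrite ffunE inordK // ltnS geq_minl. Qed.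

Lemma sig2E (A : finType) (M K : nat) (w : seq A) (x y : nat) :
  x < y -> y <= size w -> (sig M K w x y).2 = last_letters M w x y :> seq A.
Proof.
by move=> xy yw; rewrite insubdK // unfold_in size_last_letters // geq_minl.
Qed.

Lemma sig_eq (A : finType) (M K : nat) (w : seq A) (x y : nat)
    (c : {ffun M.+1.-tuple A -> 'I_K.+1}) (r : M.-bseq A) :
  x < y -> y <= size w ->
  (sig M K w x y == (c, r)) =
    [forall b, minn K (window_count (val b) w x (y - M)) == c b] &&
    (last_letters M w x y == r).
Proof.
move=> xy yw; apply/eqP/andP => [sigE|[/forallP cE /eqP rE]].
  rewrite -(sig2E M K xy yw) sigE; split=> //; apply/forallP => b.
  by rewrite -sig1E sigE.
rewrite [LHS]surjective_pairing; congr (_, _); last first.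
  by apply: val_inj; rewrite /= -rE; exact: sig2E.
by apply/ffunP => b; apply: val_inj; rewrite -[RHS](eqP (cE b)); exact: sig1E.
Qed.

(** The size of [r] separates two cases. If it is [M], the interval is cut at [y - M]: the counted
    windows start to the left of the cut and [r] is read from it. If it is smaller, [r] is the whole
    interval and no window fits. *)
Lemma good_sig (A : finType) (M K : nat) (t : signature A M K) :
  good (@betfac A) (fun w x y => (x < y) && (sig M K w x y == t)).
Proof.
case: t => c r; have r_le : size r <= M by apply: size_bseq.
have [rM|r_neq] := eqVneq (size r) M.
  (* A truncated count equal to [K] means at least [K], so those windows form [E]; any smaller value
     is exact. *)
  have := good_comp
    (good_window_counts [set b | c b == K :> nat] (fun b => c b))
    (good_test (good_shift M) (definable1_prefix r)).
  apply: good_ext => w x y; have y_lt := ltn_ord y.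
  have countE n (b : M.+1.-tuple A) : (minn K n == c b) =
      if b \in [set b | c b == K :> nat] then c b <= n else n == c b.
    rewrite inE; have := ltn_ord (c b); case: ifP => /eqP; lia.
  apply/existsP/andP => [[z]|[xy]].
    case/andP=> /and3P[xz _ /forallP cE] /andP[/eqP yE rz].
    have xy : x < y by lia.
    split=> //; rewrite sig_eq // 1?ltnW //; apply/andP; split.
      by apply/forallP => b; rewrite countE yE addnK.
    rewrite /last_letters yE addnK (maxn_idPr xz) addnC -take_drop.
    by rewrite -{1}rM -prefixE.
  rewrite sig_eq // 1?ltnW // => /andP[/forallP cE /eqP rE].
  have := size_last_letters M xy (ltnW y_lt); rewrite rE rM => MxE.
  have zP : y - M < size w by lia.
  exists (Ordinal zP); apply/andP; split; first (apply/and3P; split => /=).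
  - lia.
  - lia.
  - by apply/forallP => b; rewrite -countE; apply: cE.
  rewrite /= subnK ?eqxx /=; last lia.
  rewrite prefixE rM take_drop subnKC; last lia.
  by rewrite -rE /last_letters; have /maxn_idPr -> : x.+1 <= y - M by lia.
(* With [size r < M] every count is zero, so a signature with a nonzero count gives the empty
   relation. *)
have [/forallP c0|c_n0] := boolP [forall b, c b == 0 :> nat]; last first.
  apply: good_ext (definable2_good (definable2_const _ false)) => w x y.
  apply/esym/negP => /andP[xy]; have y_lt := ltn_ord y.
  rewrite sig_eq // 1?ltnW // => /andP[/forallP cE /eqP rE].
  case/negP: c_n0; apply/forallP => b; rewrite -(eqP (cE b)).
  have := size_last_letters M xy (ltnW y_lt); rewrite rE => szE.
  by rewrite /window_count big_geq ?minn0 //; lia.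
(* One step leads from [x] to the start of the interval, then [size r] steps along [r] lead to
   [y]. *)
have := good_comp (good_shift 1)
  (good_test (good_shift (size r)) (definable1_prefix r)).
apply: good_ext => w x y; have y_lt := ltn_ord y.
apply/existsP/andP => [[z]|[xy]].
  case/andP=> /eqP zE /andP[/eqP yE rz]; have xy : x < y by lia.
  split=> //; rewrite sig_eq // 1?ltnW //; apply/andP; split.
    apply/forallP => b; rewrite (eqP (c0 b)) /window_count big_geq ?minn0 //.
    lia.
  rewrite /last_letters; have /maxn_idPl -> : y - M <= x.+1 by lia.
  by move: rz; rewrite prefixE take_drop yE zE addn1 addnC.
rewrite sig_eq // 1?ltnW // => /andP[_ /eqP rE].
have := size_last_letters M xy (ltnW y_lt); rewrite rE => szE.
have zP : x.+1 < size w by lia.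
exists (Ordinal zP); rewrite /= addn1 eqxx /=.
have yE : y = size r + x.+1 :> nat by lia.
rewrite addnC -yE eqxx prefixE take_drop -yE -rE /last_letters.
have /maxn_idPl -> : y - M <= x.+1 by lia.
exact: eqxx.
Qed.

(** * Counting occurrences from a signature *)

Lemma prefix_take_size (A : eqType) (u t : seq A) (n : nat) :
  prefix u (take n t) = (size u <= n) && prefix u t.
Proof.
apply/idP/andP => [pu|[un /prefixP[v ->]]].
  split; last exact: prefix_trans pu (prefix_take _ _).
  by apply: leq_trans (size_prefix pu) _; rewrite size_take_min geq_minl.
by rewrite take_cat ltnNge un /= prefix_prefix.
Qed.

Definition count_factor (A : finType) (u t : seq A) : nat :=
  \sum_(i < size t) prefix u (drop i t).

(** Cutting [w] at [y] absorbs the bound on the end of an occurrence: a factor of [take y w] ends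
    before [y]. *)
Lemma card_occurrences_sum (A : finType) (u w : seq A) (x y : 'I_(size w)) :
  u != [::] ->
  #|occurrences u x y| = \sum_(x.+1 <= i < y) prefix u (drop i (take y w)).
Proof.
rewrite -size_eq0 => u_n0; rewrite big_geq_mkord.
rewrite (big_ord_widen_cond (size w) (fun i => x < i)
  (fun i => prefix u (drop i (take y w)) : nat)); last exact: ltnW.
rewrite -sum1_card big_mkcond [RHS]big_mkcond; apply: eq_bigr => i _ /=.
rewrite inE; have [xi|//] := boolP (x < i).
have [iy|iy] := ltnP i y; last by case: ifP => //= /andP[]; lia.
have -> : drop i (take y w) = take (y - i) (drop i w).
  by rewrite take_drop subnK // ltnW.
rewrite prefix_take_size /=.
have -> : (i + (size u).-1 < y) = (size u <= y - i) by lia.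
by case: (_ && _).
Qed.

(** As [size u <= M.+1], an occurrence starting before [y - M] is a prefix of the window at its
    start; the remaining occurrences lie inside the last letters. *)
Lemma card_occurrences (A : finType) (M : nat) (u w : seq A)
    (x y : 'I_(size w)) :
  u != [::] -> size u <= M.+1 -> x < y ->
  #|occurrences u x y| =
    \sum_(b : M.+1.-tuple A) prefix u b * window_count b w x (y - M) +
    count_factor u (last_letters M w x y).
Proof.
move=> u_n0 uM xy; have y_lt := ltn_ord y.
rewrite card_occurrences_sum // (@big_cat_nat _ _ _ (maxn x.+1 (y - M))) /=;
  [|lia|lia].
congr (_ + _); last first.
  rewrite -{1}[maxn _ _]add0n big_addn big_mkord /count_factor.
  have -> : size (last_letters M w x y) = y - maxn x.+1 (y - M).
    by rewrite size_drop size_takel // ltnW.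
  by apply: eq_bigr => i _; rewrite drop_drop.
have -> : \sum_(x.+1 <= i < maxn x.+1 (y - M)) prefix u (drop i (take y w)) =
    \sum_(x.+1 <= i < y - M) prefix u (drop i (take y w)).
  have [yM|//] := leqP (y - M) x.+1.
  by rewrite [LHS]big_geq // [RHS]big_geq.
rewrite /window_count; under [RHS]eq_bigr do rewrite big_distrr /=.
rewrite exchange_big /=; apply: eq_big_nat => i /andP[xi iy].
(* Exactly one window starts at [i], so only its term survives in the sum over [b]. *)
have sz : size (take M.+1 (drop i w)) == M.+1.
  by rewrite size_takel // size_drop; lia.
rewrite (bigD1 (Tuple sz)) //= prefix_take muln1 big1 ?addn0 => [|b b_neq].
  have -> : drop i (take y w) = take (y - i) (drop i w).
    by rewrite take_drop subnK //; lia.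
  rewrite !prefix_take_size uM; have -> // : size u <= y - i by lia.
by rewrite (@prefix_tuple_inj _ _ (Tuple sz)) ?prefix_take // (negPf b_neq) muln0.
Qed.

(** A term above [K] makes both sums at least [K], hence both inequalities true; without such a term
    truncation changes nothing. *)
Lemma leq_sum_minn (T : finType) (k K n : nat) (f : T -> nat) :
  k <= K -> (k <= \sum_t minn K (f t) + n) = (k <= \sum_t f t + n).
Proof.
move=> kK; have [/forallP f_le|] := boolP [forall t, f t <= K].
  by congr (_ <= _ + _); apply: eq_bigr => t _; apply/minn_idPr.
rewrite negb_forall => /existsP[t]; rewrite -ltnNge => /ltnW Kt.
rewrite (bigD1 t) // [in RHS](bigD1 t) //= (minn_idPl Kt) -!addnA.
by rewrite !(leq_trans kK) ?leq_addr // (leq_trans Kt) ?leq_addr.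
Qed.

(** * Formulas as boolean functions of colours and links *)

(** [None] stands for equal positions; the boolean tells whether the first position precedes the
    second, and the signature is always read from left to right. *)
Definition link_type (A : finType) (M K : nat) : finType :=
  option (bool * signature A M K).

Definition link (A : finType) (M K : nat) (w : seq A) (x y : nat) :
    link_type A M K :=
  if x < y then Some (true, sig M K w x y)
  else if y < x then Some (false, sig M K w y x) else None.

Lemma linkC (A : finType) (M K : nat) (w : seq A) (x y : nat) :
  link M K w y x = omap (fun bt => (~~ bt.1, bt.2)) (link M K w x y).
Proof. by rewrite /link; case: ltngtP. Qed.

Lemma link_refl (A : finType) (M K : nat) (w : seq A) (x : nat) :
  link M K w x x = None.
Proof. by rewrite /link ltnn. Qed.

Lemma good_link (A : finType) (M K : nat) (t : link_type A M K) :
  good (@betfac A) (fun w x y => link M K w x y == t).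
Proof.
case: t => [[[] t]|].
- apply: good_ext (good_sig t) => w x y; rewrite /link.
  by case: ltngtP => //= _; apply/esym/eqP => -[].
- apply: good_ext (goodC (good_sig t)) => w x y; rewrite /link.
  by case: ltngtP => //= _; apply/esym/eqP => -[].
apply: good_ext (good_shift 0) => w x y; rewrite /link addn0.
by case: ltngtP.
Qed.

Definition factored (A : finType) (M K : nat) (R : word_rel A) : Prop :=
  exists (C : finType) (p : forall w : seq A, 'I_(size w) -> C)
         (F : C -> C -> link_type A M K -> bool),
    (forall c, definable1 (@betfac A) (fun w x => p w x == c)) /\
    forall w x y, R w x y = F (p w x) (p w y) (link M K w x y).

Lemma factored_link (A : finType) (M K : nat) (G : link_type A M K -> bool) :
  factored M K (fun w x y => G (link M K w x y)).
Proof.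
exists unit, (fun _ _ => tt), (fun _ _ => G); split=> // -[].
exact: definable2_const.
Qed.

Lemma factored_unary (A : finType) (M K : nat) (T : finType)
    (p : forall w : seq A, 'I_(size w) -> T) (q : pred T) :
  (forall t, definable1 (@betfac A) (fun w x => p w x == t)) ->
  factored M K (fun w x _ => q (p w x)).
Proof. by move=> defp; exists T, p, (fun t _ _ => q t). Qed.

Lemma factoredC (A : finType) (M K : nat) (R : word_rel A) :
  factored M K R -> factored M K (fun w x y => R w y x).
Proof.
case=> C [p [F [defp RE]]].
exists C, p, (fun c d t => F d c (omap (fun bt => (~~ bt.1, bt.2)) t)).
by split=> // w x y; rewrite RE linkC.
Qed.

Lemma factored_not (A : finType) (M K : nat) (R : word_rel A) :
  factored M K R -> factored M K (fun w x y => ~~ R w x y).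
Proof.
case=> C [p [F [defp RE]]].
by exists C, p, (fun c d t => ~~ F c d t); split=> // w x y; rewrite RE.
Qed.

Lemma factored_and (A : finType) (M K : nat) (R S : word_rel A) :
  factored M K R -> factored M K S ->
  factored M K (fun w x y => R w x y && S w x y).
Proof.
case=> C [p [F [defp RE]]] [D [q [G [defq SE]]]].
exists (C * D)%type, (fun w x => (p w x, q w x)),
  (fun c d t => F c.1 d.1 t && G c.2 d.2 t).
split=> [[c d]|w x y]; last by rewrite RE SE.
exact: definable2_and (defp c) (defq d).
Qed.

(** Splitting over the finitely many triples of two colours and a link leaves, for each triple, a
    quantification over [y] with the link fixed, which goodness allows. *)
Lemma factored_exists (A : finType) (M K : nat) (R : word_rel A) :
  factored M K R -> definable1 (@betfac A) (fun w x => [exists y, R w x y]).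
Proof.
case=> C [p [F [defp RE]]].
have defF (s : C * C * link_type A M K) :
    definable1 (@betfac A) (fun w x => F s.1.1 s.1.2 s.2 &&
      ((p w x == s.1.1) &&
       [exists y : 'I_(size w), (link M K w x y == s.2) && (p w y == s.1.2)])).
  apply: definable2_and (definable2_const _ _) _.
  apply: definable2_and (defp _) _.
  exact: (proj1 (good_link s.2 (defp s.1.2))).
apply: definable2_ext (definable1_exists defF) => w x _.
apply/existsP/existsP => [[[[c d] t] /= /and3P[Fs /eqP xc /existsP[y]]]|[y xy]].
  by case/andP=> /eqP xy /eqP yd; exists y; rewrite RE xc yd xy.
exists (p w x, p w y, link M K w x y); rewrite /= -RE xy eqxx /=.
by apply/existsP; exists y; rewrite !eqxx.
Qed.

Lemma factored_diagonal (A : finType) (M K : nat) (R : word_rel A) :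
  factored M K R -> definable1 (@betfac A) (fun w x => R w x x).
Proof.
case=> C [p [F [defp RE]]].
have defF c : definable1 (@betfac A) (fun w x => F c c None && (p w x == c)).
  exact: definable2_and (definable2_const _ _) (defp c).
apply: definable2_ext (definable1_exists defF) => w x _.
rewrite RE link_refl; apply/existsP/idP => [[c /andP[Fc /eqP->]] //|Fx].
by exists (p w x); rewrite Fx eqxx.
Qed.

Definition factored_formula (A : finType) (M K : nat)
    (phi : fo2 A (nonempty_word A * nat)) : Prop :=
  exists2 R : word_rel A, factored M K R &
    forall w (e : var -> 'I_(size w)),
      sat (@thfac A) e phi = R w (e false) (e true).

(** The two arguments of an atom may be swapped or equal: a swap is absorbed by the converse, and a
    repeated variable forces the link [None]. *)
Lemma factored_atom (A : finType) (M K : nat) (S : word_rel A)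
    (G : link_type A M K -> bool) (x y : var) :
  (forall w i j, S w i j = G (link M K w i j)) ->
  exists2 R : word_rel A, factored M K R &
    forall w (e : var -> 'I_(size w)), S w (e x) (e y) = R w (e false) (e true).
Proof.
move=> SE; have const : factored M K (fun (_ : seq A) _ _ => G None).
  exact: (factored_link (fun=> G None)).
case: x y => [] [].
- by exists (fun _ _ _ => G None) => // w e; rewrite SE link_refl.
- exists (fun w i j => G (link M K w j i)); last by move=> w e; rewrite SE.
  exact: factoredC (factored_link G).
- exists (fun w i j => G (link M K w i j)); last by move=> w e; rewrite SE.
  exact: factored_link.
- by exists (fun _ _ _ => G None) => // w e; rewrite SE link_refl.
Qed.

Definition link_thfac (A : finType) (M K : nat) (uk : nonempty_word A * nat)
    (t : link_type A M K) : bool :=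
  uk.2 <= (if t is Some (true, (c, r)) then
             \sum_b prefix (val uk.1) (val b) * c b +
               count_factor (val uk.1) r
           else 0).

Lemma thfac_link (A : finType) (M K : nat) (uk : nonempty_word A * nat)
    (w : seq A) (x y : 'I_(size w)) :
  size (val uk.1) <= M.+1 -> uk.2 <= K ->
  thfac uk x y = link_thfac uk (link M K w x y).
Proof.
case: uk => -[u u_n0] k /= uM kK; rewrite /thfac /link_thfac /=.
have [xy|yx] := ltnP x y; last first.
  rewrite (_ : #|_| = 0).
    by rewrite /link ltnNge yx /=; case: ifP.
  apply: eq_card0 => z; rewrite inE; apply/negP; case/and3P; lia.
rewrite /link xy (card_occurrences u_n0 uM xy).
rewrite [sig _ _ _ _ _]surjective_pairing (sig2E M K xy (ltnW (ltn_ord y))).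
(* The signature stores counts truncated at [K], which a comparison with [k <= K] cannot distinguish
   from the true ones; truncation commutes with the coefficients because they are 0 or 1. *)
rewrite -(leq_sum_minn _ _ kK); congr (_ <= _ + _).
apply: eq_bigr => b _; rewrite sig1E.
by case: (prefix _ _); rewrite ?mul1n ?mul0n ?minn0.
Qed.

Fixpoint factor_bound (A : finType) (phi : fo2 A (nonempty_word A * nat)) :
    nat :=
  match phi with
  | Lt _ _ | Letter _ _ => 0
  | Pred uk _ _ => size (val uk.1)
  | Not psi | Ex _ psi => factor_bound psi
  | And psi chi => maxn (factor_bound psi) (factor_bound chi)
  end.

Fixpoint threshold_bound (A : finType) (phi : fo2 A (nonempty_word A * nat)) :
    nat :=
  match phi with
  | Lt _ _ | Letter _ _ => 0
  | Pred uk _ _ => uk.2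
  | Not psi | Ex _ psi => threshold_bound psi
  | And psi chi => maxn (threshold_bound psi) (threshold_bound chi)
  end.

(** [M] and [K] stay fixed through the induction, so that all subformulas share the same links and
    can be combined. *)
Lemma thfac_factored_formula (A : finType) (M K : nat)
    (phi : fo2 A (nonempty_word A * nat)) :
  factor_bound phi <= M -> threshold_bound phi <= K ->
  factored_formula M K phi.
Proof.
elim: phi => [x y|a x|uk x y|psi IH|psi IHpsi chi IHchi|x psi IH] /=.
- move=> _ _; pose G (t : link_type A M K) := if t is Some (b, _) then b else false.
  apply: (@factored_atom _ _ _ (fun w i j => i < j) G) => w i j.
  by rewrite /G /link; case: ltngtP.
- move=> _ _.
  have defA b := definable1_letter (@betfac A) b.
  have unary := factored_unary M K (pred1 a) defA.
  case: x; last by exists (fun w i _ => tnth (in_tuple w) i == a).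
  by exists (fun w _ j => tnth (in_tuple w) j == a) => //; apply: factoredC unary.
- move=> uM kK; apply: (@factored_atom _ _ _ (thfac uk) (link_thfac uk)).
  by move=> w i j; apply: thfac_link => //; apply: leqW.
- move=> uM kK; have [R factR satE] := IH uM kK.
  exists (fun w i j => ~~ R w i j); first exact: factored_not.
  by move=> w e /=; rewrite satE.
- rewrite !geq_max => /andP[uM1 uM2] /andP[kK1 kK2].
  have [R factR psiE] := IHpsi uM1 kK1; have [S factS chiE] := IHchi uM2 kK2.
  exists (fun w i j => R w i j && S w i j); first exact: factored_and.
  by move=> w e /=; rewrite psiE chiE.
move=> uM kK; have [R factR satE] := IH uM kK.
(* The truth value of a quantified formula becomes a new two-valued colour of the remaining
   position. *)
have unary (S : word_rel A) : factored M K S ->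
    factored M K (fun w i _ => [exists j, S w i j]).
  move/factored_exists=> defS.
  apply: (@factored_unary _ M K _ (fun w i => [exists j, S w i j]) id) => -[].
    by apply: definable2_ext defS => w i _; rewrite eqb_id.
  by apply: definable2_ext (definable2_not defS) => w i _; rewrite eqbF_neg.
case: x.
  exists (fun w i _ => [exists j, R w i j]); first exact: unary.
  by move=> w e /=; apply: eq_existsb => j; rewrite satE.
exists (fun w _ j => [exists i, R w i j]).
  exact: factoredC (unary _ (factoredC factR)).
by move=> w e /=; apply: eq_existsb => j; rewrite satE.
Qed.

Lemma thfac_factored (A : finType) (phi : fo2 A (nonempty_word A * nat)) :
  factored_formula (factor_bound phi) (threshold_bound phi) phi.
Proof. exact: thfac_factored_formula. Qed.

(** * Translations between the two logics *)

Fixpoint thfac_of_betfac (A : finType) (phi : fo2 A (nonempty_word A)) :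
    fo2 A (nonempty_word A * nat) :=
  match phi with
  | Lt x y => Lt A _ x y
  | Letter a x => Letter _ a x
  | Pred u x y => Pred A (u, 1) x y
  | Not psi => Not (thfac_of_betfac psi)
  | And psi chi => And (thfac_of_betfac psi) (thfac_of_betfac chi)
  | Ex x psi => Ex x (thfac_of_betfac psi)
  end.

Lemma free_thfac_of_betfac (A : finType) (phi : fo2 A (nonempty_word A))
    (v : var) :
  free v (thfac_of_betfac phi) = free v phi.
Proof. by elim: phi => //= [psi -> chi ->|x psi ->]. Qed.

Lemma sat_thfac_of_betfac (A : finType) (phi : fo2 A (nonempty_word A))
    (w : seq A) (e : var -> 'I_(size w)) :
  sat (@thfac A) e (thfac_of_betfac phi) = sat (@betfac A) e phi.
Proof.
elim: phi e => //= [u x y|psi IH|psi IHpsi chi IHchi|x psi IH] e.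
- by apply/card_gt0P/existsP.
- by rewrite IH.
- by rewrite IHpsi IHchi.
by apply: eq_existsb => i; rewrite IH.
Qed.

Lemma definable_language_thfac_betfac (A : finType)
    (L : nonempty_word A -> Prop) :
  definable_language (@thfac A) L -> definable_language (@betfac A) L.
Proof.
case=> phi _ defL; have [R factR phiE] := thfac_factored phi.
have [psi psiE] := factored_exists (factored_not factR) false.
(* The sentence says that no pair of positions violates [R]. The value of [psi] depends only on
   [false]; quantifying [true] as well closes the formula syntactically. *)
exists (Not (Ex false (Ex true psi))); first by case.
move=> w; rewrite (defL w); split=> [sat_phi e /=|sat_psi e].
  rewrite negb_exists; apply/forallP => i; rewrite negb_exists.
  apply/forallP => j; rewrite psiE negb_exists; apply/forallP => k.
  have := sat_phi (fun v => if v then k else i).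
  by rewrite phiE negbK.
have /= := sat_psi e; rewrite negb_exists => /forallP/(_ (e false)).
rewrite negb_exists => /forallP/(_ (e false)); rewrite psiE negb_exists.
by move/forallP/(_ (e true)); rewrite negbK phiE.
Qed.

Lemma definable_marked_thfac_betfac (A : finType)
    (M : marked_word A -> Prop) :
  definable_marked (@thfac A) M -> definable_marked (@betfac A) M.
Proof.
case=> _ [phi [_ defM]]; have [R factR phiE] := thfac_factored phi.
have [psi psiE] := factored_diagonal factR false.
(* Both variables sit at the marked position, so [R] matters only on the diagonal; the quantifier on
   [true] only removes a possible free occurrence. *)
exists false, (Ex true psi); split=> [[]|w i] //.
rewrite defM phiE /=; split=> [Ri|/existsP[j]]; last by rewrite psiE.
by apply/existsP; exists i; rewrite psiE.
Qed.

Theorem theorem2p7 (A : finType) :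
  (forall L : nonempty_word A -> Prop,
     definable_language (@betfac A) L <-> definable_language (@thfac A) L) /\
  (forall M : marked_word A -> Prop,
     definable_marked (@betfac A) M <-> definable_marked (@thfac A) M).
Proof.
split=> [L|M]; split.
- case=> phi sent_phi defL; exists (thfac_of_betfac phi).
    by move=> v; rewrite free_thfac_of_betfac.
  by move=> w; rewrite (defL w); split=> sat_phi e;
    move: (sat_phi e); rewrite sat_thfac_of_betfac.
- exact: definable_language_thfac_betfac.
- case=> v [phi [free_phi defM]]; exists v, (thfac_of_betfac phi).
  split=> [v'|w i]; first by rewrite free_thfac_of_betfac; apply: free_phi.
  by rewrite sat_thfac_of_betfac.
- exact: definable_marked_thfac_betfac.
Qed.
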